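(* Let $n\ge2$, let $r>0$, let $S$ be the unit sphere in $\mathbb R^n$, and let $g:S\to\mathbb R$ be a $C^2$ odd function (i.e. $g(-u)=-g(u)$ for all $u\in S$). Extend $g$ to $\mathbb R^n\setminus 0$ by $g(x)=|x|\,g(x/|x|)$ and let $H:\mathbb R^n\setminus0\to\mathbb R^n$ be the gradient of this extension. Suppose that at every point $u\in S$ all eigenvalues of the matrix $\left(\frac{\partial^2 g}{\partial x_i\partial x_j}(u)\right)_{i,j}$ lie in $[-(r/2),(r/2)]$. Then $$\{H(u)+t(r/2)u:(u,t)\in S\times[-1,1]\}=\{H(u)+t(r/2)u:(u,t)\in S\times[0,1]\},$$ and this subset $C$ of $\mathbb R^n$ is a solid (compact convex set) of constant diameter $r$, and so is an $r$-maximal set.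
   Context: $\mathbb R^n$ has the usual Euclidean metric. A set $C\subset\mathbb R^n$ has constant diameter $r$ if $\sup\{u\cdot(x_1-x_2):x_1,x_2\in C\}=r$ for every $u\in S$. A subset of $\mathbb R^n$ is $r$-bounded if its diameter is at most $r$; it is $r$-maximal if it is maximal (with respect to inclusion) among the $r$-bounded subsets of $\mathbb R^n$. *)

(* Defs.v *)
From HB Require Import structures.
From mathcomp Require Import all_boot all_order all_algebra.
From mathcomp Require Import all_classical all_reals all_analysis.

Set Implicit Arguments.
Unset Strict Implicit.
Unset Printing Implicit Defensive.

Import Order.TTheory GRing.Theory Num.Theory.
Import numFieldNormedType.Exports.

Local Open Scope classical_set_scope.
Local Open Scope ring_scope.

(* Vectors of R^n are row vectors. The library norm `|x| on 'rV[R]_n is the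
   max norm, so the Euclidean norm is introduced separately; both induce the
   same topology, hence the library notions of open, compact, continuous and
   differentiable are the Euclidean ones. *)
Definition dotp (R : realType) (n : nat) (x y : 'rV[R]_n) : R :=
  \sum_(i < n) x ord0 i * y ord0 i.

Definition enorm (R : realType) (n : nat) (x : 'rV[R]_n) : R :=
  Num.sqrt (dotp x x).

Definition usphere (R : realType) (n : nat) : set 'rV[R]_n :=
  [set u | enorm u = 1].
Arguments usphere R n : clear implicits.

Definition pderiv (R : realType) (n : nat) (i : 'I_n) (f : 'rV[R]_n -> R) :
  'rV[R]_n -> R := fun x => 'D_(delta_mx ord0 i) f x.

Definition grad (R : realType) (n : nat) (f : 'rV[R]_n -> R) (x : 'rV[R]_n) :
  'rV[R]_n := \row_i pderiv i f x.

Definition hessian (R : realType) (n : nat) (f : 'rV[R]_n -> R)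
  (x : 'rV[R]_n) : 'M[R]_n := \matrix_(i, j) pderiv i (pderiv j f) x.

(* C^k functions on U, meant for U open. *)
Fixpoint Ck_on (R : realType) (n : nat) (k : nat) (U : set 'rV[R]_n)
    (f : 'rV[R]_n -> R) : Prop :=
  match k with
  | 0%N => forall x, U x -> {for x, continuous f}
  | k'.+1 => (forall x, U x -> differentiable f x) /\
             (forall i : 'I_n, Ck_on k' U (pderiv i f))
  end.

(* A function on the sphere is represented by a function g on R^n of which only
   the values on the sphere matter; it is C^k when it locally extends to C^k
   functions on open subsets of R^n. *)
Definition Ck_usphere (R : realType) (n : nat) (k : nat)
    (g : 'rV[R]_n -> R) : Prop :=
  forall u, usphere R n u ->
    exists (U : set 'rV[R]_n) (f : 'rV[R]_n -> R),
      [/\ open U, U u, Ck_on k U f &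
          forall x, U x -> usphere R n x -> f x = g x].

(* Only the values of g on the unit sphere enter here (the value at 0 is 0). *)
Definition homog_ext (R : realType) (n : nat) (g : 'rV[R]_n -> R)
  (x : 'rV[R]_n) : R := enorm x * g ((enorm x)^-1 *: x).

(* Suprema are taken in the extended reals, so that unbounded sets have
   diameter +oo (and the empty set has diameter -oo). *)
Definition diameter (R : realType) (n : nat) (A : set 'rV[R]_n) : \bar R :=
  ereal_sup [set (enorm (x - y))%:E | x in A & y in A].

Definition bounded_by (R : realType) (n : nat) (r : R) (A : set 'rV[R]_n) :
  Prop := (diameter A <= r%:E)%E.

Definition maximal_by (R : realType) (n : nat) (r : R) (A : set 'rV[R]_n) :
  Prop :=
  bounded_by r A /\ forall B, bounded_by r B -> A `<=` B -> B = A.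

Definition constant_diameter (R : realType) (n : nat) (r : R)
    (C : set 'rV[R]_n) : Prop :=
  forall u, usphere R n u ->
    ereal_sup [set (dotp u (x1 - x2))%:E | x1 in C & x2 in C] = r%:E.

Definition solid (R : realType) (n : nat) (C : set 'rV[R]_n) : Prop :=
  compact C /\ convex_set (C : set (convex_lmodType 'rV[R]_n)).

(* Main.v *)
Require Import Defs.
From HB Require Import structures.
From mathcomp Require Import all_boot all_order all_algebra.
From mathcomp Require Import all_classical all_reals all_analysis.
From mathcomp Require Import ring lra.

Set Implicit Arguments.
Unset Strict Implicit.
Unset Printing Implicit Defensive.

Import Order.TTheory GRing.Theory Num.Theory.
Import numFieldNormedType.Exports.

Local Open Scope classical_set_scope.
Local Open Scope ring_scope.

(** Write [G] for the extension of [g] that is homogeneous of degree one (since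
    [g] is odd, [G (c x) = c G x] for every real [c]), [H] for its gradient and
    [rho = r / 2].  The set [C] turns out to be the body whose support function
    on the sphere is [h u = G u + rho], that is the intersection [K] of the
    half-spaces [x . u <= h u]; everything else can be read off [h].

    The points of [C] lie in [K].  As [H (- u) = H u], each segment making up
    [C] has end points [H u + rho u] and [H (- u) + rho (- u)], so it is enough
    that [(H u + rho u) . w <= h w] for all unit vectors [u] and [w]
    ([support_inequality]).  Move [u] to [w] along an arc [gam] of great circle
    of length [theta].  Since [w = cos (theta - s) gam s + sin (theta - s) gam' s]
    and the Hessian of [G] kills the radial direction, the derivative of
    [s |-> (H (gam s) + rho gam s) . w] is
    [sin (theta - s) (gam' . Hess G . gam' + rho)].  It is nonnegative as soon as
    the Hessian is bounded below by [- rho] as a quadratic form, and by Euler's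
    identity [H w . w = G w] the final value of the function is [h w].  The
    bound on the quadratic form is the bound on the eigenvalues, by the
    variational characterization of the least eigenvalue
    ([quadratic_form_ge]); this uses the symmetry of second derivatives
    ([pderivC]).

    Conversely each point [x] of [K] is [H u + m u] with [0 <= m <= rho]
    ([support_parametrization]): let [u] minimize [y |-> G y - x . y] on the
    sphere and let [- m] be the minimum, which is at most zero by oddness and at
    least [- rho] because [x] is in [K].  By homogeneity [u] minimizes
    [G y - x . y + m |y|] among all [y], so that the gradient of this function,
    [H u - x + m u], is zero.  Hence [K] is already covered by the half segments
    [t >= 0], and the two descriptions of [C] agree.

    Finally [h u + h (- u) = r], and the hyperplane [x . u = h u] meets [K] at
    [H u + rho u].  A body with these two properties has width [r] in all
    directions.  It is also maximal: a point at distance at most [r] from the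
    contact point for [- u] satisfies [x . u <= h u]. *)

(** * Euclidean geometry of row vectors *)

Section Euclidean.
Context {R : realType} {n : nat}.
Implicit Types (x y z : 'rV[R]_n) (a : R).

Lemma dotpC x y : dotp x y = dotp y x.
Proof. by apply: eq_bigr => i _; rewrite mulrC. Qed.

Lemma dotpDl x y z : dotp (x + y) z = dotp x z + dotp y z.
Proof. by rewrite -big_split; apply: eq_bigr => i _ /=; rewrite mxE mulrDl. Qed.

Lemma dotpZl a x z : dotp (a *: x) z = a * dotp x z.
Proof. by rewrite mulr_sumr; apply: eq_bigr => i _; rewrite mxE mulrA. Qed.

Lemma dotpDr x y z : dotp z (x + y) = dotp z x + dotp z y.
Proof. by rewrite dotpC dotpDl !(dotpC _ z). Qed.

Lemma dotpZr a x z : dotp z (a *: x) = a * dotp z x.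
Proof. by rewrite dotpC dotpZl (dotpC z). Qed.

Lemma dotpNl x z : dotp (- x) z = - dotp x z.
Proof. by rewrite -scaleN1r dotpZl mulN1r. Qed.

Lemma dotpNr x z : dotp z (- x) = - dotp z x.
Proof. by rewrite dotpC dotpNl (dotpC z). Qed.

Lemma dotpBl x y z : dotp (x - y) z = dotp x z - dotp y z.
Proof. by rewrite dotpDl dotpNl. Qed.

Lemma dotpBr x y z : dotp z (x - y) = dotp z x - dotp z y.
Proof. by rewrite dotpDr dotpNr. Qed.

Lemma dotp0l z : dotp 0 z = 0.
Proof. by rewrite -(scale0r 0) dotpZl mul0r. Qed.

Lemma dotp_deltar x i : dotp x (delta_mx ord0 i) = x ord0 i.
Proof.
rewrite /dotp (bigD1 i) //= mxE !eqxx mulr1 big1 ?addr0 // => j ji.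
by rewrite mxE (negbTE ji) mulr0.
Qed.

Lemma dotp_ge0 x : 0 <= dotp x x.
Proof. by apply: sumr_ge0 => i _; rewrite -expr2 sqr_ge0. Qed.

Lemma dotp_eq0 x : (dotp x x == 0) = (x == 0).
Proof.
apply/idP/eqP => [|->]; last by rewrite dotp0l.
rewrite psumr_eq0 => [/allP x0|i _]; last by rewrite -expr2 sqr_ge0.
apply/rowP => i; rewrite mxE; apply/eqP.
by have := x0 i (mem_index_enum i); rewrite /= mulf_eq0 orbb.
Qed.

Lemma dotp_inj x y : (forall v, dotp x v = dotp y v) -> x = y.
Proof.
by move=> xy; apply/rowP => i; rewrite -!dotp_deltar xy.
Qed.

Lemma enorm_ge0 x : 0 <= enorm x. Proof. exact: sqrtr_ge0. Qed.

Lemma enorm_sqr x : enorm x ^+ 2 = dotp x x.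
Proof. by rewrite sqr_sqrtr ?dotp_ge0. Qed.

Lemma enorm_eq0 x : (enorm x == 0) = (x == 0).
Proof. by rewrite -dotp_eq0 -enorm_sqr sqrf_eq0. Qed.

Lemma enorm0 : enorm (0 : 'rV[R]_n) = 0.
Proof. by apply/eqP; rewrite enorm_eq0. Qed.

Lemma enorm_gt0 x : (0 < enorm x) = (x != 0).
Proof. by rewrite lt_neqAle enorm_ge0 andbT eq_sym enorm_eq0. Qed.

Lemma enormZ a x : enorm (a *: x) = `|a| * enorm x.
Proof.
by rewrite /enorm dotpZl dotpZr mulrA -expr2 sqrtrM ?sqr_ge0 // sqrtr_sqr.
Qed.

Lemma enormN x : enorm (- x) = enorm x.
Proof. by rewrite -scaleN1r enormZ normrN1 mul1r. Qed.

Lemma usphereP x : usphere R n x <-> dotp x x = 1.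
Proof.
rewrite /usphere /= -enorm_sqr; split=> [->|/eqP]; first exact: expr1n.
rewrite sqrf_eq1 => /orP[/eqP //|/eqP x1].
by have := enorm_ge0 x; rewrite x1 oppr_ge0 ler10.
Qed.

Lemma usphereN x : usphere R n x -> usphere R n (- x).
Proof. by rewrite /usphere /= enormN. Qed.

Lemma usphere_neq0 x : usphere R n x -> x != 0.
Proof. by rewrite -enorm_gt0 => ->. Qed.

Lemma usphere_normalize x : x != 0 -> usphere R n ((enorm x)^-1 *: x).
Proof.
move=> x0; rewrite /usphere /= enormZ ger0_norm ?invr_ge0 ?enorm_ge0 //.
by rewrite mulVf ?enorm_eq0.
Qed.

Lemma enorm_normalizeK x : x != 0 -> enorm x *: ((enorm x)^-1 *: x) = x.
Proof. by move=> x0; rewrite scalerA mulfV ?enorm_eq0 ?scale1r. Qed.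

Lemma dotp_usphere_le1 x y : usphere R n x -> usphere R n y -> dotp x y <= 1.
Proof.
move=> /usphereP xx /usphereP yy; have := dotp_ge0 (x - y).
by rewrite dotpBl !dotpBr xx yy (dotpC y); lra.
Qed.

Lemma dotp_le_enorm x y : usphere R n y -> dotp x y <= enorm x.
Proof.
move=> yS; have [->|x0] := eqVneq x 0; first by rewrite dotp0l enorm_ge0.
rewrite -[in leLHS](enorm_normalizeK x0) dotpZl ler_piMr ?enorm_ge0 //.
exact/dotp_usphere_le1/yS/usphere_normalize.
Qed.

Lemma dotp_normalize x : x != 0 -> dotp ((enorm x)^-1 *: x) x = enorm x.
Proof.
by move=> x0; rewrite dotpZl -enorm_sqr expr2 mulrA mulVf ?mul1r // enorm_eq0.
Qed.

Lemma coord_le_enorm x i : `|x ord0 i| <= enorm x.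
Proof.
rewrite -(ler_pXn2r (n := 2)) ?nnegrE ?enorm_ge0 // enorm_sqr real_normK ?num_real //.
rewrite /dotp (bigD1 i) //= -expr2 lerDl sumr_ge0 // => j _.
by rewrite -expr2 sqr_ge0.
Qed.

Lemma differentiable_dotp y x : differentiable (fun z => dotp z y) x.
Proof.
rewrite (_ : (fun z => _) = \sum_(i < n) (fun z => z ord0 i * y ord0 i)); last first.
  by apply/funext => z; rewrite fct_sumE.
apply: differentiable_sum => i; apply: differentiableM => //.
exact: differentiable_coord.
Qed.

Lemma differentiable_dotpxx x : differentiable (fun z : 'rV[R]_n => dotp z z) x.
Proof.
rewrite (_ : (fun z => _) = \sum_(i < n) (fun z => z ord0 i * z ord0 i)); last first.
  by apply/funext => z; rewrite fct_sumE.
by apply: differentiable_sum => i; apply: differentiableM; exact: differentiable_coord.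
Qed.

Lemma continuous_enorm : continuous (@enorm R n).
Proof.
move=> x; apply: (@continuous_comp _ _ _ (fun z => dotp z z) Num.sqrt).
  exact/differentiable_continuous/differentiable_dotpxx.
exact: sqrt_continuous.
Qed.

Lemma compact_bounded_coord (A : set 'rV[R]_n) M :
  (forall x i, A x -> `|x ord0 i| <= M) -> closed A -> compact A.
Proof.
move=> AM; apply: bounded_closed_compact; exists `|M|; split; first exact: num_real.
move=> K MK x Ax; have K0 : 0 < K by rewrite (le_lt_trans _ MK).
rewrite /globally /= /Num.Def.normr/= mx_normrE (bigmax_le _ (ltW K0)) //= => -[i j] _ /=.
by rewrite (ord1 i) (le_trans (AM _ _ Ax)) // (le_trans (ler_norm _)) // ltW.
Qed.

Lemma compact_usphere : compact (usphere R n).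
Proof.
apply: (@compact_bounded_coord _ 1) => [x i xS|].
  by rewrite -[leRHS]xS coord_le_enorm.
rewrite (_ : usphere R n = @enorm R n @^-1` [set 1]) //.
by apply: closed_comp => [x _|]; [exact: continuous_enorm|exact: closed_eq].
Qed.

End Euclidean.

(** * Calculus of C^k functions *)

Lemma derive_grad (R : realType) n (f : 'rV[R]_n -> R) x v :
  differentiable f x -> 'D_v f x = dotp v (grad f x).
Proof.
move=> df; rewrite deriveE // [in LHS](row_sum_delta v) linear_sum.
by apply: eq_bigr => i _; rewrite linearZ mxE /pderiv deriveE.
Qed.

Section SmoothFunctions.
Context {R : realType} {n : nat}.
Implicit Types (f g : 'rV[R]_n -> R) (U : set 'rV[R]_n) (x v : 'rV[R]_n).

Lemma near_eq_differentiable f g x :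
  (\near x, f x = g x) -> differentiable f x -> differentiable g x.
Proof.
move=> fg df; have fgx : f x = g x by exact: nbhs_singleton fg.
have dfo := diff_locally df.
have dgo : g \o shift x = cst (g x) + 'd f x +o_ (0 : 'rV[R]_n) id.
  apply/eqaddoP => e e0; have /eqaddoP /(_ e e0) := dfo.
  have : \forall h \near (0 : 'rV[R]_n), f (h + x) = g (h + x).
    by move: fg; rewrite (near_shift 0) subr0.
  by apply: filterS2 => h /= fgh; rewrite !fctE /= -fgx -fgh.
have dc : continuous ('d f x) by exact: diff_continuous.
by apply/diff_locallyP; rewrite (diff_unique dc dgo).
Qed.

Lemma Ck_eq k U f g : open U -> (forall x, U x -> f x = g x) ->
  Ck_on k U f -> Ck_on k U g.
Proof.
move=> Uo; elim: k f g => [|k IH] f g fg.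
  move=> cf x Ux; have fgx : \near x, f x = g x.
    by apply: filterS fg _; exact: open_nbhs_nbhs.
  rewrite /prop_for /continuous_at -(fg x Ux); apply: cvg_trans (cf x Ux).
  exact: near_eq_cvg fgx.
move=> [df Cf].
have fgx x : U x -> \near x, f x = g x.
  by move=> Ux; apply: filterS fg _; exact: open_nbhs_nbhs.
split=> [x Ux|i]; first exact: near_eq_differentiable (fgx x Ux) (df x Ux).
apply: IH (Cf i) => x Ux; exact/near_eq_derive/fgx.
Qed.

Lemma Ck_subset k U V f : U `<=` V -> Ck_on k V f -> Ck_on k U f.
Proof.
move=> UV; elim: k f => [|k IH] f; first by move=> cf x /UV /cf.
move=> [df Cf]; split=> [x /UV /df //|i]; exact: IH (Cf i).
Qed.

Lemma Ck_pred k U f : Ck_on k.+1 U f -> Ck_on k U f.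
Proof.
elim: k f => [|k IH] f [df Cf]; first by move=> x /df /differentiable_continuous.
by split=> // i; exact: IH (Cf i).
Qed.

Lemma Ck_cst k U (a : R) : Ck_on k U (fun=> a).
Proof.
elim: k a => [|k IH] a; first by move=> x _; apply: cst_continuous.
split=> [x _|i]; first exact: differentiable_cst.
rewrite (_ : pderiv i _ = fun=> 0) //; apply/funext => x.
exact: derive_cst.
Qed.

Lemma CkD k U f g : open U -> Ck_on k U f -> Ck_on k U g ->
  Ck_on k U (fun x => f x + g x).
Proof.
move=> Uo; elim: k f g => [|k IH] f g.
  by move=> cf cg x Ux; exact: cvgD (cf x Ux) (cg x Ux).
move=> [df Cf] [dg Cg]; split=> [x Ux|i].
  by apply: differentiableD; [exact: df|exact: dg].
apply: Ck_eq Uo _ (IH _ _ (Cf i) (Cg i)) => x Ux.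
by rewrite /pderiv deriveD //; apply: diff_derivable; [exact: df|exact: dg].
Qed.

Lemma CkM k U f g : open U -> Ck_on k U f -> Ck_on k U g ->
  Ck_on k U (fun x => f x * g x).
Proof.
move=> Uo; elim: k f g => [|k IH] f g.
  by move=> cf cg x Ux; exact: cvgM (cf x Ux) (cg x Ux).
move=> Cf1 Cg1; have [df Cf] := Cf1; have [dg Cg] := Cg1.
split=> [x Ux|i]; first by apply: differentiableM; [exact: df|exact: dg].
apply: Ck_eq Uo _ (CkD Uo (IH _ _ (Ck_pred Cf1) (Cg i)) (IH _ _ (Ck_pred Cg1) (Cf i))).
move=> x Ux.
by rewrite /pderiv deriveM //; apply: diff_derivable; [exact: df|exact: dg].
Qed.

Lemma Ck_sum k U m (F : 'I_m -> 'rV[R]_n -> R) : open U ->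
  (forall i, Ck_on k U (F i)) -> Ck_on k U (fun x => \sum_i F i x).
Proof.
move=> Uo; elim: m F => [|m IH] F CF.
  by under eq_fun do rewrite big_ord0; exact: Ck_cst.
by under eq_fun do rewrite big_ord_recr; apply: CkD => //; exact: IH.
Qed.

Lemma derive_coord (v x : 'rV[R]_n) i : 'D_v (fun y : 'rV[R]_n => y ord0 i) x = v ord0 i.
Proof.
have /derive_mx := @derivable_id R 'rV[R]_n x v.
by rewrite derive_id => /rowP /(_ i); rewrite mxE => <-.
Qed.

Lemma Ck_coord k U i : Ck_on k U (fun x => x ord0 i).
Proof.
case: k => [x _|k]; first exact: coord_continuous.
split=> [x _|j]; first exact: differentiable_coord.
rewrite (_ : pderiv j _ = fun=> (delta_mx ord0 j : 'rV[R]_n) ord0 i).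
  exact: Ck_cst.
by apply/funext => x; exact: derive_coord.
Qed.

Lemma differentiable_row m (phi : 'rV[R]_n -> 'rV[R]_m) x :
  (forall j, differentiable (fun y => phi y ord0 j) x) -> differentiable phi x.
Proof.
move=> dphi.
rewrite (_ : phi = \sum_(j < m) (fun y => phi y ord0 j *: delta_mx ord0 j)).
  by apply: differentiable_sum => j; exact: differentiableZl.
by apply/funext => y; rewrite fct_sumE [LHS](row_sum_delta (phi y)).
Qed.

Lemma continuous_row m (phi : 'rV[R]_n -> 'rV[R]_m) x :
  (forall j, {for x, continuous (fun y => phi y ord0 j)}) ->
  {for x, continuous phi}.
Proof.
move=> cphi.
rewrite (_ : phi = \sum_(j < m) (fun y => phi y ord0 j *: delta_mx ord0 j)).
  elim/big_ind : _ => [|f g cf cg|j _]; first exact: (@cst_continuous _ _ (0 : 'rV[R]_m)).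
    exact: continuousD cf cg.
  by apply: (@cvgZr_tmp _ _ _ (nbhs x)); exact: (cphi j).
by apply/funext => y; rewrite fct_sumE [LHS](row_sum_delta (phi y)).
Qed.

(** By the chain rule the partial derivatives of [f \o phi] are sums of products
    of those of [phi] and of compositions with partial derivatives of [f], to
    which the induction hypothesis applies. *)
Lemma Ck_comp m k U (V : set 'rV[R]_m) (f : 'rV[R]_m -> R) (phi : 'rV[R]_n -> 'rV[R]_m) :
  open U -> (forall x, U x -> V (phi x)) ->
  (forall j, Ck_on k U (fun x => phi x ord0 j)) ->
  Ck_on k V f -> Ck_on k U (fun x => f (phi x)).
Proof.
move=> Uo UV; elim: k f => [|k IH] f Cphi.
  move=> cf x Ux; apply: (@continuous_comp _ _ _ phi f); last exact: cf (UV _ Ux).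
  by apply: continuous_row => j; exact: Cphi.
move=> [df Cf].
have dphi x : U x -> differentiable phi x.
  by move=> Ux; apply: differentiable_row => j; case: (Cphi j) => /(_ x Ux).
split=> [x Ux|i].
  by apply: (differentiable_comp (dphi x Ux)); exact: df (UV _ Ux).
have C1 : Ck_on k U (fun x => \sum_(j < m) pderiv i (fun y => phi y ord0 j) x *
    pderiv j f (phi x)).
  apply: Ck_sum => // j; apply: CkM => //; first by case: (Cphi j) => _ /(_ i).
  by apply: IH (Cf j) => l; exact/Ck_pred/Cphi.
apply: Ck_eq Uo _ C1 => x Ux.
have dfx := df _ (UV _ Ux); have dphix := dphi _ Ux.
have dfphi : differentiable (f \o phi) x by exact: differentiable_comp.
rewrite /pderiv -[RHS]/('D_(delta_mx ord0 i) (f \o phi) x) (deriveE _ dfphi).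
rewrite (diff_comp dphix dfx) /= -(deriveE _ dphix) -(deriveE _ dfx) (derive_grad _ dfx).
rewrite (derive_mx (diff_derivable dphix)).
by apply: eq_bigr => j _; rewrite !mxE.
Qed.

End SmoothFunctions.

(** * Smoothness of the norm and of the homogeneous extension *)

Section NormDerivatives.
Context {R : realType} {n : nat}.
Implicit Types (x v y : 'rV[R]_n).

Lemma derive_dotp y v x : 'D_v (fun z => dotp z y) x = dotp v y.
Proof.
have -> : (fun z => dotp z y) = \sum_(i < n) (fun z : 'rV[R]_n => z ord0 i * y ord0 i).
  by apply/funext => z; rewrite fct_sumE.
have dc i : derivable (fun z : 'rV[R]_n => z ord0 i) x v.
  exact/diff_derivable/differentiable_coord.
rewrite derive_sum => [|i]; last first.
  by apply: derivableM => //; exact: derivable_cst.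
apply: eq_bigr => i _; rewrite deriveM //.
by rewrite derive_cst derive_coord scaler0 add0r mulrC.
Qed.

Lemma derive_dotpxx v x : 'D_v (fun z : 'rV[R]_n => dotp z z) x = 2 * dotp x v.
Proof.
have -> : (fun z => dotp z z) = \sum_(i < n) (fun z : 'rV[R]_n => z ord0 i * z ord0 i).
  by apply/funext => z; rewrite fct_sumE.
have dc i : derivable (fun z : 'rV[R]_n => z ord0 i) x v.
  exact/diff_derivable/differentiable_coord.
rewrite derive_sum => [|i]; last exact: derivableM.
rewrite mulr_sumr; apply: eq_bigr => i _; rewrite deriveM // derive_coord.
by rewrite -mulr2n [RHS]mulr_natl.
Qed.

Lemma differentiable_enorm x : x != 0 -> differentiable (@enorm R n) x.
Proof.
move=> x0; apply: (@differentiable_comp _ _ _ _ (fun z => dotp z z) Num.sqrt).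
  exact: differentiable_dotpxx.
apply/derivable1_diffP; apply: ex_derive; apply: is_derive1_sqrt.
by rewrite -enorm_sqr exprn_gt0 // enorm_gt0.
Qed.

Lemma derive_enorm v x : x != 0 -> 'D_v (@enorm R n) x = (enorm x)^-1 * dotp x v.
Proof.
move=> x0; have e0 : enorm x != 0 by rewrite enorm_eq0.
have de : derivable (@enorm R n) x v.
  exact/diff_derivable/differentiable_enorm.
have := derive_dotpxx v x.
have -> : (fun z => dotp z z) = @enorm R n * @enorm R n.
  by apply/funext => z; rewrite -enorm_sqr.
rewrite deriveM // -mulr2n -[_ *: _]/(_ * _) -mulr_natl => D2.
by apply: (mulfI e0); rewrite mulVKf //; lra.
Qed.

Lemma open_neq0 : open [set x : 'rV[R]_n | x != 0].
Proof.
rewrite (_ : mkset _ = ~` (@enorm R n @^-1` [set 0])); last first.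
  by apply/seteqP; split => x /=; rewrite -enorm_eq0 => /eqP.
apply: closed_openC; apply: closed_comp => [x _|]; last exact: closed_eq.
exact: continuous_enorm.
Qed.

(** The partial derivatives of [1 / |x|] are [- x_i / |x|^3], that is
    polynomials in the coordinates and in [1 / |x|] itself; smoothness thus
    follows by induction on its order. *)
Lemma Ck_inv_enorm k : Ck_on k [set x : 'rV[R]_n | x != 0] (fun x => (enorm x)^-1).
Proof.
elim: k => [|k IH].
  move=> x x0; apply: differentiable_continuous.
  by apply: differentiableV; [exact: differentiable_enorm|rewrite enorm_eq0].
split=> [x x0|i].
  by apply: differentiableV; [exact: differentiable_enorm|rewrite enorm_eq0].
have o := open_neq0.
have C1 := CkM o (CkM o (Ck_cst k _ (-1)) (Ck_coord k _ i))
  (CkM o IH (CkM o IH IH)).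
apply: Ck_eq o _ C1 => x /= x0.
have e0 : enorm x != 0 by rewrite enorm_eq0.
rewrite /pderiv deriveV //; last exact/diff_derivable/differentiable_enorm.
rewrite derive_enorm // dotp_deltar -[_ *: _]/(_ * _).
by field.
Qed.

Lemma Ck_enorm k : Ck_on k [set x : 'rV[R]_n | x != 0] (@enorm R n).
Proof.
have o := open_neq0.
have C1 := CkM o (Ck_sum o (fun i => CkM o (Ck_coord k _ i) (Ck_coord k _ i)))
  (Ck_inv_enorm k).
apply: Ck_eq o _ C1 => x /= x0.
by rewrite -[\sum_(i < n) _]/(dotp x x) -enorm_sqr expr2 mulfK // enorm_eq0.
Qed.

Lemma Ck_local k (U : set 'rV[R]_n) (f : 'rV[R]_n -> R) :
  (forall x, U x -> exists2 V, nbhs x V & Ck_on k V f) -> Ck_on k U f.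
Proof.
elim: k f => [|k IH] f locf.
  by move=> x /locf[V xV cf]; exact: cf (nbhs_singleton xV).
split=> [x /locf[V xV [df _]]|i]; first exact: df (nbhs_singleton xV).
by apply: IH => x /locf[V xV [_ /(_ i) Cf]]; exists V.
Qed.

(** Around a point [x], the extension is [|y| f (y / |y|)] for a smooth local
    extension [f] of [g] around [x / |x|]. *)
Lemma Ck_homog_ext k (g : 'rV[R]_n -> R) : Ck_usphere k g ->
  Ck_on k [set x | x != 0] (homog_ext g).
Proof.
move=> Cg; apply: Ck_local => x /= x0.
have [U [f [Uo Uu Cf fg]]] := Cg _ (usphere_normalize x0).
have o := open_neq0.
pose phi (y : 'rV[R]_n) := (enorm y)^-1 *: y.
pose V := [set y | y != 0] `&` phi @^-1` U.
have Cphi j : Ck_on k [set y | y != 0] (fun y => phi y ord0 j).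
  apply: Ck_eq o _ (CkM o (Ck_inv_enorm k) (Ck_coord k _ j)) => y _.
  by rewrite mxE.
have cphi y : y != 0 -> {for y, continuous phi}.
  move=> y0; apply: continuous_row => j.
  have /(_ y y0) := CkM o (Ck_inv_enorm 0) (Ck_coord 0 _ j).
  by under [X in _ -> {for _, continuous X}]eq_fun do rewrite mxE.
have Vo : open V.
  rewrite openE => y [y0 Uy]; rewrite /interior; near=> z; split; near: z.
    exact: open_nbhs_nbhs.
  by apply: cphi => //; exact: open_nbhs_nbhs.
exists V; first exact: open_nbhs_nbhs.
have VU : V `<=` [set y | y != 0] by move=> y [].
apply: Ck_eq Vo _ (CkM Vo (Ck_subset VU (Ck_enorm k))
   (Ck_comp Vo _ (fun j => Ck_subset VU (Cphi j)) Cf)) => [y [y0 Uy]|y []//].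
by rewrite /homog_ext fg //; exact: usphere_normalize.
Unshelve. all: by end_near. Qed.

End NormDerivatives.

(** * Symmetry of second derivatives *)

Section SecondDerivatives.
Context {R : realType} {n : nat}.
Implicit Types (f : 'rV[R]_n -> R) (U : set 'rV[R]_n) (x a b : 'rV[R]_n).

Lemma is_derive_curve f (gam : R -> 'rV[R]_n) s w :
  differentiable f (gam s) -> is_derive s 1 gam w ->
  is_derive s 1 (fun s => f (gam s)) ('D_w f (gam s)).
Proof.
move=> df [/derivable1_diffP dgam Dgam].
have dfgam : differentiable (f \o gam) s by exact: differentiable_comp.
apply: DeriveDef; first exact/derivable1_diffP.
rewrite -[LHS]/('D_1 (f \o gam) s) (deriveE _ dfgam) (diff_comp dgam df) /=.
by rewrite -(deriveE _ dgam) Dgam deriveE.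
Qed.

Lemma is_derive_line (V : normedModType R) (c a : V) (s : R) :
  is_derive s 1 (fun s => s *: a + c) a.
Proof.
have -> : (fun s => s *: a + c) = ( *:%R^~ a) + cst c by [].
have dl : is_derive s 1 ( *:%R^~ a : R -> _) a.
  apply: DeriveDef; first exact/derivable1_diffP.
  by rewrite deriveE // diff_val scale1r.
by apply: is_derive_eq; rewrite addr0.
Qed.

(** The mean value theorem along [a] turns the second difference into a
    difference of values of the derivative along [a], to which the theorem is
    applied again along [b]. *)
Lemma second_difference f x a b (h : R) : 0 < h ->
  (forall s t, 0 <= s <= h -> 0 <= t <= h ->
    differentiable f (s *: a + (t *: b + x)) /\
    differentiable ('D_a f) (s *: a + (t *: b + x))) ->
  exists s t, [/\ 0 <= s <= h, 0 <= t <= h &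
    f (h *: a + (h *: b + x)) - f (h *: a + x) - f (h *: b + x) + f x
      = h ^+ 2 * 'D_b ('D_a f) (s *: a + (t *: b + x))].
Proof.
move=> h0 df.
have hh : 0 <= h <= h by rewrite lexx ltW.
have h00 : 0 <= (0:R) <= h by rewrite lexx ltW.
pose phi s := f (s *: a + (h *: b + x)) - f (s *: a + x).
pose dphi s := 'D_a f (s *: a + (h *: b + x)) - 'D_a f (s *: a + x).
have itvoo_cc s : s \in `]0, h[%R -> 0 <= s <= h.
  by rewrite in_itv /= => /andP[/ltW-> /ltW->].
have phi' s : 0 <= s <= h -> is_derive s 1 phi (dphi s).
  move=> sh; apply: is_deriveB; apply: is_derive_curve; try exact: is_derive_line.
    exact: (df s h sh hh).1.
  by have := (df s 0 sh h00).1; rewrite scale0r add0r.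
have [s /andP[s0 sh] ephi] : exists2 s, 0 <= s <= h & phi h - phi 0 = dphi s * (h - 0).
  have [|s sh e] := MVT h0 (df := dphi) (f := phi) (fun s sh => phi' s (itvoo_cc _ sh)).
    apply: derivable_within_continuous => s sh.
    by apply: ex_derive; apply: phi'; move: sh; rewrite in_itv.
  by exists s => //; exact: itvoo_cc.
have shh : 0 <= s <= h by rewrite s0.
pose psi t := 'D_a f (t *: b + (s *: a + x)).
pose dpsi t := 'D_b ('D_a f) (t *: b + (s *: a + x)).
have psi' t : 0 <= t <= h -> is_derive t 1 psi (dpsi t).
  move=> th; apply: is_derive_curve; last exact: is_derive_line.
  by rewrite addrCA; exact: (df s t shh th).2.
have [t th epsi] : exists2 t, 0 <= t <= h & psi h - psi 0 = dpsi t * (h - 0).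
  have [|t th e] := MVT h0 (df := dpsi) (f := psi) (fun t th => psi' t (itvoo_cc _ th)).
    apply: derivable_within_continuous => t th.
    by apply: ex_derive; apply: psi'; move: th; rewrite in_itv.
  by exists t => //; exact: itvoo_cc.
exists s, t; split=> //.
transitivity (phi h - phi 0); first by rewrite /phi scale0r !add0r; ring.
rewrite ephi; have -> : dphi s = psi h - psi 0.
  by rewrite /dphi /psi scale0r add0r (addrCA (s *: a)).
by rewrite epsi /dpsi (addrCA (t *: b)) subr0; ring.
Qed.

(** The same second difference is [h^2] times a value near [x] of either mixed
    derivative; both being continuous, they agree at [x]. *)
Lemma pderivC U f x i j : open U -> U x -> Ck_on 2 U f ->
  pderiv i (pderiv j f) x = pderiv j (pderiv i f) x.
Proof.
move=> Uo Ux [df Cf].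
have dD k : forall y, U y -> differentiable (pderiv k f) y by case: (Cf k).
have cD k l : {for x, continuous (pderiv l (pderiv k f))}.
  by case: (Cf k) => _ /(_ l); apply.
pose a : 'rV[R]_n := delta_mx ord0 i; pose b : 'rV[R]_n := delta_mx ord0 j.
apply/eqP; rewrite -subr_eq0 -normr_eq0 eq_le normr_ge0 andbT.
apply/ler_addgt0Pr => e e0; rewrite add0r.
have e2 : 0 < e / 2 by rewrite divr_gt0.
have nearP k l : \forall y \near x,
    `|pderiv l (pderiv k f) x - pderiv l (pderiv k f) y| < e / 2.
  have /cvgrPdist_lt := cD k l; exact.
have nearU : nbhs x U by exact: open_nbhs_nbhs.
have : nbhs x [set y | [/\ U y,
    `|pderiv i (pderiv j f) x - pderiv i (pderiv j f) y| < e / 2 &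
    `|pderiv j (pderiv i f) x - pderiv j (pderiv i f) y| < e / 2]].
  by apply: filterS3 nearU (nearP j i) (nearP i j) => y.
move=> /nbhs_normP[d /= d0 near_x].
pose h := d / 2 / (`|a| + `|b| + 1).
have M0 : 0 < `|a| + `|b| + 1 by rewrite ltr_wpDl // addr_ge0.
have h0 : 0 < h by rewrite !divr_gt0.
have box s t : 0 <= s <= h -> 0 <= t <= h -> `|x - (s *: a + (t *: b + x))| < d.
  move=> /andP[s0 sh] /andP[t0 th].
  rewrite addrA opprD addrCA subrr addr0 normrN.
  rewrite (le_lt_trans (ler_normD _ _)) // !normrZ !ger0_norm //.
  apply: (@le_lt_trans _ _ (h * (`|a| + `|b| + 1))); last first.
    by rewrite /h divfK ?gt_eqF // ltr_pdivrMr //; lra.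
  have := ler_wpM2r (normr_ge0 a) sh; have := ler_wpM2r (normr_ge0 b) th.
  by move: h0; clear; nra.
have box' s t : 0 <= s <= h -> 0 <= t <= h -> `|x - (s *: b + (t *: a + x))| < d.
  by move=> sh th; rewrite addrCA; exact: box.
have [s [t [sh th e1]]] := @second_difference f x a b h h0
  (fun s t sh th => let: And3 Uy _ _ := near_x _ (box s t sh th) in
    conj (df _ Uy) (dD i _ Uy)).
have [s' [t' [sh' th' e1']]] := @second_difference f x b a h h0
  (fun s t sh th => let: And3 Uy _ _ := near_x _ (box' s t sh th) in
    conj (df _ Uy) (dD j _ Uy)).
have [_ _ le1] := near_x _ (box s t sh th).
have [_ le2 _] := near_x _ (box' s' t' sh' th').
have : h ^+ 2 * 'D_b ('D_a f) (s *: a + (t *: b + x))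
  = h ^+ 2 * 'D_a ('D_b f) (s' *: b + (t' *: a + x)).
  apply: (etrans (esym e1)); apply: (etrans _ e1').
  by rewrite (addrCA (h *: a)) -!addrA; congr (_ + _); rewrite addrCA.
move/(mulfI (lt0r_neq0 (exprn_gt0 2 h0))) => E.
move: le1 le2; rewrite [pderiv j (pderiv i f) (s *: _ + _)]E.
rewrite -[pderiv i (pderiv j f) (s' *: _ + _)]/('D_a ('D_b f) (s' *: b + (t' *: a + x))).
move: ('D_a _ _) (pderiv i _ x) (pderiv j _ x) => w p q qw pw.
apply: ltW; rewrite (splitr e) -(subrKA w).
apply: le_lt_trans (ler_normD _ _) _; apply: ltrD; first exact: pw.
by move: qw; rewrite distrC.
Qed.

End SecondDerivatives.

(** * Quadratic forms *)

Section Rayleigh.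
Context {R : realType} {n : nat}.
Implicit Types (M : 'M[R]_n) (v w : 'rV[R]_n).

Lemma dotp_mulmxC M v w : (forall i j, M i j = M j i) ->
  dotp (v *m M) w = dotp v (w *m M).
Proof.
move=> Msym; rewrite /dotp.
under eq_bigr do rewrite mxE mulr_suml.
under [RHS]eq_bigr do rewrite mxE mulr_sumr.
rewrite exchange_big; apply: eq_bigr => i _; apply: eq_bigr => j _.
by rewrite Msym; ring.
Qed.

Lemma continuous_quadratic_form M : continuous (fun v => dotp (v *m M) v).
Proof.
move=> v; suff /(_ v I) : Ck_on 0 setT (fun v => dotp (v *m M) v) by [].
have o := @openT 'rV[R]_n.
have C := Ck_sum o (fun i => CkM o (Ck_sum o (fun j => CkM o (Ck_coord 0 setT j)
  (Ck_cst 0 setT (M j i)))) (Ck_coord 0 setT i)).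
apply: Ck_eq o _ C => w _.
by apply: eq_bigr => i _; rewrite mxE.
Qed.

(** Applied to a nonnegative form on a line through one of its null vectors, this
    shows that the null vector lies in the kernel of the form. *)
Lemma discriminant_eq0 (b c : R) : (forall t, 0 <= 2 * t * b + t ^+ 2 * c) -> b = 0.
Proof.
move=> pos; apply/eqP; apply: contraT => b0.
have b2 : 0 < b ^+ 2 by rewrite lt_neqAle sqr_ge0 eq_sym sqrf_eq0 b0.
have c1 : 0 < `|c| + 1 by rewrite ltr_wpDl.
(* any [t] of sign opposite to [b] and small enough gives a negative value *)
have := pos (- b / (`|c| + 1)).
have -> : 2 * (- b / (`|c| + 1)) * b + (- b / (`|c| + 1)) ^+ 2 * c
   = b ^+ 2 / (`|c| + 1) ^+ 2 * (c - 2 * (`|c| + 1)).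
  by field; rewrite gt_eqF.
have p : 0 < b ^+ 2 / (`|c| + 1) ^+ 2 by rewrite divr_gt0 // exprn_gt0.
rewrite (pmulr_rge0 _ p) => H.
by have := ler_norm c; move: (normr_ge0 c) => ? ?; exfalso; lra.
Qed.

(** The form attains its minimum on the unit sphere at some [u]; as [u] is then a
    minimum of the form [w M w - (u M u) (w . w)], it is in the kernel of that
    form, so the minimum is an eigenvalue. *)
Lemma quadratic_form_ge M (m : R) v : (forall i j, M i j = M j i) ->
  (forall a, eigenvalue M a -> m <= a) -> m * dotp v v <= dotp (v *m M) v.
Proof.
move=> Msym eigM; have [->|v0] := eqVneq v 0; first by rewrite mul0mx !dotp0l mulr0.
pose q w := dotp (w *m M) w.
have [||u uS umin] := @EVT_min_rV R n q (usphere R n) _ compact_usphere.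
- by exists ((enorm v)^-1 *: v); exact: usphere_normalize.
- exact/continuous_subspaceT/continuous_quadratic_form.
have {}uS : usphere R n u by rewrite inE in uS.
have qZ c w : q (c *: w) = c ^+ 2 * q w.
  by rewrite /q -scalemxAl dotpZl dotpZr; ring.
have qge w : q u * dotp w w <= q w.
  have [->|w0] := eqVneq w 0; first by rewrite /q mul0mx !dotp0l mulr0.
  rewrite -[in leRHS](enorm_normalizeK w0) qZ -enorm_sqr mulrC.
  apply: ler_wpM2l; first exact: sqr_ge0.
  by apply: umin; rewrite inE; exact: usphere_normalize.
have /usphereP uu := uS.
suff uM : u *m M = q u *: u.
  apply: le_trans (qge v); apply: ler_wpM2r; first exact: dotp_ge0.
  by apply: eigM; apply/eigenvalueP; exists u => //; exact: usphere_neq0.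
apply: dotp_inj => w; apply/eqP; rewrite -subr_eq0; apply/eqP.
apply: (@discriminant_eq0 _ (q w - q u * dotp w w)) => t.
have := qge (u + t *: w); rewrite -subr_ge0 => /le_trans -> //.
rewrite le_eqVlt; apply/orP; left; apply/eqP.
rewrite [q (_ + _)]/q mulmxDl -scalemxAl !(dotpDl, dotpDr, dotpZl, dotpZr) uu.
rewrite (dotpC w u) (dotp_mulmxC w u Msym) (dotpC w (u *m M)).
by rewrite -/(q u) -/(q w); ring.
Qed.

End Rayleigh.

(** * Homogeneous functions of degree one *)

Section Homogeneous.
Context {R : realType} {n : nat} (G : 'rV[R]_n -> R).
Hypothesis GZ : forall c x, G (c *: x) = c * G x.
Hypothesis GC : Ck_on 2 [set x | x != 0] G.
Implicit Types (x y u v w : 'rV[R]_n).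

Let H := grad G.

Lemma homog_differentiable x : x != 0 -> differentiable G x.
Proof. by case: GC => + _; apply. Qed.

Lemma homog_differentiable_pderiv i x : x != 0 -> differentiable (pderiv i G) x.
Proof. by case: GC => _ /(_ i)[+ _]; apply. Qed.

Lemma homog_grad_scale c x : c != 0 -> x != 0 -> H (c *: x) = H x.
Proof.
move=> c0 x0; apply/rowP => i; rewrite !mxE /pderiv; set e := delta_mx _ _.
have cx0 : c *: x != 0 by rewrite scaler_eq0 negb_or c0.
have d1 : is_derive (0 : R) 1 (fun s => G (s *: e + c *: x)) ('D_e G (c *: x)).
  rewrite -[X in 'D_e G X]add0r -[X in 'D_e G (X + _)](scale0r e).
  apply: is_derive_curve; last exact: is_derive_line.
  by rewrite scale0r add0r; exact: homog_differentiable.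
have d2 : is_derive (0 : R) 1 (fun s => c * G (s *: (c^-1 *: e) + x))
    (c * 'D_(c^-1 *: e) G x).
  apply: is_deriveZ.
  rewrite -[X in 'D_(_ *: e) G X]add0r -[X in 'D_(_ *: e) G (X + _)](scale0r (c^-1 *: e)).
  apply: is_derive_curve; last exact: is_derive_line.
  by rewrite scale0r add0r; exact: homog_differentiable.
have E : (fun s : R => G (s *: e + c *: x)) = (fun s => c * G (s *: (c^-1 *: e) + x)).
  by apply/funext => s; rewrite -GZ scalerDr !scalerA mulrAC mulfV // mul1r.
have := @derive_val _ _ _ _ _ _ _ d1; rewrite E (@derive_val _ _ _ _ _ _ _ d2) => <-.
rewrite !derive_grad ?dotpZl ?mulVKf //; exact: homog_differentiable.
Qed.

Lemma homog_euler x : x != 0 -> dotp (H x) x = G x.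
Proof.
move=> x0; rewrite dotpC -derive_grad; last exact: homog_differentiable.
have d1 : is_derive (0 : R) 1 (fun s => G (s *: x + x)) ('D_x G x).
  rewrite -[X in 'D_x G X]add0r -[X in 'D_x G (X + _)](scale0r x).
  apply: is_derive_curve; last exact: is_derive_line.
  by rewrite scale0r add0r; exact: homog_differentiable.
have d2 : is_derive (0 : R) 1 (fun s => G (s *: x + x)) (G x).
  have -> : (fun s => G (s *: x + x)) = (fun s : R => s *: G x + G x).
    by apply/funext => s; rewrite -[X in _ + X]scale1r -scalerDl GZ mulrDl mul1r.
  exact: is_derive_line.
by rewrite -(@derive_val _ _ _ _ _ _ _ d1) (@derive_val _ _ _ _ _ _ _ d2).
Qed.

Lemma derive_pderiv v x j : x != 0 ->
  'D_v (pderiv j G) x = (v *m hessian G x) ord0 j.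
Proof.
move=> x0; rewrite derive_grad; last exact: homog_differentiable_pderiv.
by rewrite mxE; apply: eq_bigr => i _; rewrite !mxE.
Qed.

Lemma hessian_sym x i j : x != 0 -> hessian G x i j = hessian G x j i.
Proof. by move=> x0; rewrite !mxE; exact: pderivC open_neq0 x0 GC. Qed.

(** The gradient is homogeneous of degree zero, hence constant along rays. *)
Lemma homog_hessian_radial x : x != 0 -> x *m hessian G x = 0.
Proof.
move=> x0; apply/rowP => j; rewrite -derive_pderiv // [RHS]mxE.
have d1 : is_derive (0 : R) 1 (fun s => pderiv j G (s *: x + x)) ('D_x (pderiv j G) x).
  rewrite -[X in 'D_x _ X]add0r -[X in 'D_x _ (X + _)](scale0r x).
  apply: is_derive_curve; last exact: is_derive_line.
  by rewrite scale0r add0r; exact: homog_differentiable_pderiv.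
have d2 : is_derive (0 : R) 1 (fun s => pderiv j G (s *: x + x)) 0.
  apply: (@near_eq_is_derive _ _ _ (cst (pderiv j G x))).
  near=> s.
  have s1 : s + 1 != 0.
    suff : -1 < s by move=> s1; rewrite gt_eqF //; lra.
    near: s; exists 1 => //= s; rewrite /ball_ /= sub0r normrN ltr_norml.
    by case/andP.
  rewrite -[X in _ + X]scale1r -scalerDl.
  by have /rowP /(_ j) := homog_grad_scale s1 x0; rewrite !mxE => ->.
by rewrite -(@derive_val _ _ _ _ _ _ _ d1) (@derive_val _ _ _ _ _ _ _ d2).
Unshelve. all: by end_near. Qed.

End Homogeneous.

(** * The support function inequality and its converse *)

Section Support.
Context {R : realType} {n : nat} (G : 'rV[R]_n -> R) (rho : R).
Hypothesis GZ : forall c x, G (c *: x) = c * G x.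
Hypothesis GC : Ck_on 2 [set x | x != 0] G.
Implicit Types (x y u v w : 'rV[R]_n).

Let H := grad G.

Lemma is_derive_circle u v (s : R) :
  is_derive s 1 (fun s => cos s *: u + sin s *: v) (- sin s *: u + cos s *: v).
Proof.
have dZ (f : R -> R) df y : is_derive s 1 f df ->
    is_derive s 1 (fun s => f s *: y) (df *: y).
  move=> [/derivable1_diffP dfs Dfs].
  have dfy : differentiable (fun s => f s *: y) s by exact: differentiableZl.
  apply: DeriveDef; first exact/derivable1_diffP.
  by rewrite deriveE // diffZl // -Dfs deriveE.
by apply: is_deriveD; apply: dZ.
Qed.

(** With [x] and [y] the position and the velocity of a unit-speed motion on
    the sphere, and [M] the Hessian at [x], the left-hand side is the rate of
    change of [(H x + rho x) . w] for [w = a x + b y]. *)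
Lemma moving_frame_form (M : 'M[R]_n) x y (a b : R) :
  (forall i j, M i j = M j i) -> x *m M = 0 -> dotp y y = 1 -> dotp y x = 0 ->
  dotp (y *m M) (a *: x + b *: y) + rho * dotp y (a *: x + b *: y)
    = b * (dotp (y *m M) y + rho).
Proof.
move=> Msym xM yy yx; rewrite !(dotpDr, dotpZr) yy yx (dotp_mulmxC y x Msym) xM.
by rewrite (dotpC y 0) dotp0l; ring.
Qed.

(** The function [s |-> (H (gam s) + rho gam s) . w] is nondecreasing along the
    arc [gam] from [u] to [w]: its derivative is given by [moving_frame_form]
    with [b = sin (theta - s)], which is nonnegative on an arc of length at most
    [pi]. *)
Lemma support_inequality_circle u v w (theta : R) :
  (forall x, usphere R n x -> forall a, eigenvalue (hessian G x) a -> - rho <= a) ->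
  usphere R n u -> usphere R n v -> dotp u v = 0 -> 0 <= theta <= pi ->
  w = cos theta *: u + sin theta *: v ->
  dotp (H u + rho *: u) w <= dotp (H w + rho *: w) w.
Proof.
move=> eigG /usphereP uu /usphereP vv uv thpi w_def.
pose gam s := cos s *: u + sin s *: v.
pose gam' s := - sin s *: u + cos s *: v.
pose K y := \sum_(j < n) pderiv j G y * w ord0 j + rho * dotp y w.
have KE y : K y = dotp (H y + rho *: y) w.
  rewrite dotpDl dotpZl; congr (_ + _).
  by apply: eq_bigr => j _; rewrite mxE.
have gamS s : usphere R n (gam s).
  apply/usphereP; rewrite !(dotpDl, dotpDr, dotpZl, dotpZr) uu vv (dotpC v u) uv.
  by have := cos2Dsin2 s; move: (cos s) (sin s) => c d; lra.
have gam'1 s : dotp (gam' s) (gam' s) = 1.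
  rewrite !(dotpDl, dotpDr, dotpZl, dotpZr) uu vv (dotpC v u) uv.
  by have := cos2Dsin2 s; move: (cos s) (sin s) => c d; lra.
have gam_gam' s : dotp (gam' s) (gam s) = 0.
  rewrite !(dotpDl, dotpDr, dotpZl, dotpZr) uu vv (dotpC v u) uv.
  by ring.
(* the endpoint of the arc in the moving frame *)
have wE s : w = cos (theta - s) *: gam s + sin (theta - s) *: gam' s.
  rewrite /gam /gam' !scalerDr !scalerA addrACA -!scalerDl cosB sinB.
  have := cos2Dsin2 s.
  rewrite w_def; move: (cos s) (sin s) (cos theta) (sin theta) => c d ct st cd.
  have e1 : ct = (ct * c + st * d) * c + (st * c - ct * d) * - d.
    by rewrite -[LHS]mulr1 -cd; ring.
  have e2 : st = (ct * c + st * d) * d + (st * c - ct * d) * c.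
    by rewrite -[LHS]mulr1 -cd; ring.
  by rewrite -e1 -e2.
have gam0 s : gam s != 0 by exact/usphere_neq0/gamS.
have dK y x : y != 0 -> differentiable K y /\
    'D_x K y = dotp (x *m hessian G y) w + rho * dotp x w.
  move=> y0.
  have dpd j : differentiable (pderiv j G) y by exact: homog_differentiable_pderiv.
  have dw : differentiable (fun z => dotp z w) y by exact: differentiable_dotp.
  have -> : K = \sum_(j < n) (fun z => pderiv j G z * w ord0 j)
                + (fun z => rho * dotp z w).
    by apply/funext => z; rewrite !fctE fct_sumE.
  have dsum : differentiable (\sum_(j < n) (fun z => pderiv j G z * w ord0 j)) y.
    by apply: differentiable_sum => j; exact: differentiableM.
  have drho : differentiable (fun z => rho * dotp z w) y.
    exact: differentiableM.
  split; first exact: differentiableD.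
  rewrite deriveD; try exact: diff_derivable.
  congr (_ + _).
    rewrite derive_sum => [|j]; last exact/diff_derivable/differentiableM.
    apply: eq_bigr => j _; rewrite deriveMr; last exact: diff_derivable.
    by rewrite derive_pderiv // mulrC.
  by rewrite deriveMl ?derive_dotp //; exact: diff_derivable.
have dq (s : R) : is_derive s 1 (fun s => K (gam s)) ('D_(gam' s) K (gam s)).
  apply: is_derive_curve; last exact: is_derive_circle.
  by have [] := dK _ (gam' s) (gam0 s).
have q'_ge0 s : 0 <= s <= theta -> 0 <= 'D_(gam' s) K (gam s).
  move=> /andP[s0 sth].
  have [_ ->] := dK _ (gam' s) (gam0 s).
  have Msym i j : hessian G (gam s) i j = hessian G (gam s) j i.
    exact: hessian_sym.
  have radial := homog_hessian_radial GZ GC (gam0 s).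
  rewrite (wE s) (moving_frame_form _ _ Msym radial (gam'1 s) (gam_gam' s)).
  have sin0 : 0 <= sin (theta - s).
    by apply: sin_ge0_pi; case/andP: thpi => ? ?; apply/andP; split; lra.
  have : - rho * dotp (gam' s) (gam' s) <= dotp (gam' s *m hessian G (gam s)) (gam' s).
    by apply: quadratic_form_ge => // a; exact: eigG.
  rewrite (gam'1 s) mulr1 => le; apply: mulr_ge0 => //.
  by rewrite -lerBlDr sub0r.
have -> : u = gam 0 by rewrite /gam cos0 sin0 scale1r scale0r addr0.
have -> : dotp (H w + rho *: w) w = K (gam theta).
  by rewrite KE /gam -w_def.
rewrite -KE; case/andP: thpi => th0 thpi.
apply: (@ger0_derive1_ndecr R (fun s => K (gam s)) 0 theta) => //.
- move=> s; rewrite in_itv /= => /andP[/ltW s0 /ltW sth].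
  by rewrite derive1E derive_val q'_ge0 ?s0.
- by apply: derivable_within_continuous => s _.
Qed.

Lemma arc_between u w : usphere R n u -> usphere R n w -> w != u -> w != - u ->
  exists v theta, [/\ usphere R n v, dotp u v = 0, 0 <= theta <= pi &
    w = cos theta *: u + sin theta *: v].
Proof.
move=> uS wS wu wNu; have /usphereP uu := uS; have /usphereP ww := wS.
pose c := dotp u w; pose z := w - c *: u.
have c_le1 : -1 <= c <= 1.
  by rewrite dotp_usphere_le1 // andbT lerNl -dotpNl dotp_usphere_le1 //; exact: usphereN.
have uz : dotp u z = 0 by rewrite dotpBr dotpZr uu mulr1 subrr.
have zz : dotp z z = 1 - c ^+ 2.
  by rewrite {2}/z dotpBr dotpZr (dotpC z u) uz mulr0 subr0 /z dotpBl dotpZl ww -/c expr2.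
have z0 : z != 0.
  rewrite -dotp_eq0 zz subr_eq0 eq_sym sqrf_eq1 negb_or.
  apply/andP; split; apply/eqP => c1.
    case/negP: wu; rewrite -subr_eq0 -dotp_eq0 dotpBl !dotpBr ww uu (dotpC w).
    by rewrite -/c c1; apply/eqP; ring.
  case/negP: wNu; rewrite -subr_eq0 opprK -dotp_eq0 dotpDl !dotpDr ww uu (dotpC w).
    by rewrite -/c c1; apply/eqP; ring.
exists ((enorm z)^-1 *: z), (acos c); split.
- exact: usphere_normalize.
- by rewrite dotpZr uz mulr0.
- by rewrite acos_ge0 ?acos_lepi.
- rewrite acosK ?in_itv // sin_acos // -zz -/(enorm z) enorm_normalizeK //.
  by rewrite addrC subrK.
Qed.

(** This is the gradient inequality for the convex function
    [h x = G x + rho |x|]: homogeneity makes [h w >= h u + grad h u . (w - u)]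
    read [grad h u . w <= h w].  If [u] and [w] span a plane, it holds the arc
    along which the slope is monotone; otherwise [w] is [u] or [- u]. *)
Lemma support_inequality u w : 0 <= rho ->
  (forall x, usphere R n x -> forall a, eigenvalue (hessian G x) a -> - rho <= a) ->
  usphere R n u -> usphere R n w -> dotp (H u + rho *: u) w <= G w + rho.
Proof.
move=> rho0 eigG uS wS; have /usphereP uu := uS; have /usphereP ww := wS.
have Hw : dotp (H w + rho *: w) w = G w + rho.
  by rewrite dotpDl dotpZl ww homog_euler ?usphere_neq0 // mulr1.
have [->|wu] := eqVneq u w; first by rewrite Hw.
have [->|wNu] := eqVneq w (- u).
  rewrite dotpNr dotpDl dotpZl uu homog_euler ?usphere_neq0 //.
  by have := GZ (-1) u; rewrite scaleN1r => ->; lra.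
rewrite eq_sym in wu.
have [v [theta [vS uv thpi E]]] := arc_between uS wS wu wNu.
by rewrite -Hw; exact: support_inequality_circle E.
Qed.

(** A minimum point [u] of [y |-> G y - x . y] on the sphere, with minimum
    [- m], is by homogeneity a global minimum of [y |-> G y - x . y + m |y|];
    there the gradient [H u - x + m u] vanishes. *)
Lemma support_parametrization x e : usphere R n e ->
  (forall u, usphere R n u -> dotp x u <= G u + rho) ->
  exists u m, [/\ usphere R n u, 0 <= m <= rho & x = H u + m *: u].
Proof.
move=> eS xle.
pose F y := G y - dotp x y.
have dxE : dotp x = (fun z => dotp z x) by apply/funext => z; rewrite dotpC.
have dx y : differentiable (dotp x) y.
  by rewrite dxE; exact: differentiable_dotp.
have FZ c y : F (c *: y) = c * F y by rewrite /F GZ dotpZr mulrBr.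
have [||u uS umin] := @EVT_min_rV R n F (usphere R n) _ compact_usphere.
- by exists e.
- apply: continuous_in_subspaceT => y; rewrite inE => yS.
  have y0 := usphere_neq0 yS.
  apply: continuousB; apply: differentiable_continuous.
    exact: homog_differentiable.
  exact: dx.
have {}uS : usphere R n u by rewrite inE in uS.
have {}umin y : usphere R n y -> F u <= F y by move=> yS; apply: umin; rewrite inE.
have /usphereP uu := uS.
pose m := - F u.
have u0 := usphere_neq0 uS.
exists u, m; split=> //.
  have := umin _ (usphereN uS).
  have -> : F (- u) = - F u by rewrite -scaleN1r FZ mulN1r.
  move=> FN; have xu := xle _ uS; apply/andP; split; rewrite /m; first by lra.
  by rewrite /F; lra.
pose K y := F y + m * enorm y.
have K_ge0 y : 0 <= K y.
  have [->|y0] := eqVneq y 0.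
    have := FZ 0 0; rewrite /K scale0r mul0r => ->.
    by rewrite enorm0 mulr0 addr0.
  have := umin _ (usphere_normalize y0).
  rewrite FZ mulrC ler_pdivlMr ?enorm_gt0 //.
  by rewrite /K /m; lra.
have Ku : K u = 0 by rewrite /K /m uS; ring.
have dG y : y != 0 -> differentiable G y by exact: homog_differentiable.
have dm y : y != 0 -> differentiable (fun z => m * enorm z) y.
  by move=> y0; apply: differentiableM => //; exact: differentiable_enorm.
have dK y : y != 0 -> differentiable K y.
  by move=> y0; apply: differentiableD; [apply: differentiableB|]; auto.
have DK v : 'D_v K u = dotp v (H u) - dotp v x + m * dotp u v.
  have -> : K = (G - dotp x) + (fun z => m * enorm z) by [].
  have [d1 d2 d3] : [/\ derivable G u v, derivable (dotp x) u v &
      derivable (fun z => m * enorm z) u v].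
    by split; apply: diff_derivable; auto.
  rewrite deriveD //; last exact: derivableB.
  rewrite deriveB // derive_grad; last exact: dG.
  rewrite deriveMl; last exact/diff_derivable/differentiable_enorm.
  rewrite derive_enorm // uS invr1 mul1r.
  by rewrite dxE derive_dotp.
have DK0 v : 'D_v K u = 0.
  (* a radius within which the line through [u] avoids the origin *)
  pose d := (enorm v + 1)^-1.
  have v1 : 0 < enorm v + 1 by rewrite ltr_wpDl // enorm_ge0.
  have d0 : 0 < d by rewrite invr_gt0.
  have line0 s : s \in `]- d, d[%R -> s *: v + u != 0.
    rewrite in_itv /= -ltr_norml => sd; apply/negP; rewrite addr_eq0 => /eqP svu.
    have : enorm (s *: v) = 1 by rewrite svu enormN.
    rewrite enormZ => e1; have : `|s| * (enorm v + 1) < 1.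
      by rewrite -ltr_pdivlMr // div1r.
    by rewrite mulrDr e1; have := normr_ge0 s; lra.
  have dKl s : s \in `]- d, d[%R -> is_derive s 1 (fun s => K (s *: v + u))
      ('D_v K (s *: v + u)).
    by move=> /line0 s0; apply: is_derive_curve (dK _ s0) _; exact: is_derive_line.
  have i0 : 0 \in `]- d, d[%R by rewrite in_itv /= oppr_lt0 d0.
  have := @derive1_at_min R (fun s => K (s *: v + u)) (- d) d 0.
  case=> [|s sd|//|s sd|_ <-].
  - by rewrite ge0_cp // ltW.
  - by apply: ex_derive; exact: dKl.
  - by rewrite scale0r add0r Ku.
  have := dKl 0 i0; rewrite scale0r add0r => d'.
  by rewrite (@derive_val _ _ _ _ _ _ _ d').
apply: dotp_inj => v; have := DK v; rewrite DK0 dotpDl dotpZl (dotpC x) (dotpC (H u)).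
by lra.
Qed.

End Support.

(** * Bodies of constant width *)

Section ConstantWidth.
Context {R : realType} {n : nat}.
Implicit Types (h : 'rV[R]_n -> R) (x y u v : 'rV[R]_n).

Definition halfspace_body h : set 'rV[R]_n :=
  [set x | forall u, usphere R n u -> dotp x u <= h u].

Lemma usphere_delta (i : 'I_n) : usphere R n (delta_mx ord0 i).
Proof. by apply/usphereP; rewrite dotp_deltar mxE !eqxx. Qed.

(** An intersection of closed half-spaces is closed and convex; the constraints
    in the directions of plus and minus the basis vectors bound it. *)
Lemma solid_halfspace_body h : solid (halfspace_body h).
Proof.
split; last first.
  move=> x y l; rewrite !inE => Cx Cy u uS; rewrite /conv /= dotpDl !dotpZl.
  have l0 : 0 <= l%:num by [].
  have l1 : l%:num <= 1 by [].
  have := ler_wpM2l l0 (Cx u uS).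
  have l1' : 0 <= 1 - l%:num by rewrite subr_ge0.
  have := ler_wpM2l l1' (Cy u uS).
  by rewrite /unstable.onem; lra.
pose M := \sum_(i < n) (`|h (delta_mx ord0 i)| + `|h (- delta_mx ord0 i)|).
apply: (@compact_bounded_coord _ _ _ M) => [x i Cx|].
  have S1 := usphere_delta i.
  have := Cx _ S1; have := Cx _ (usphereN S1); rewrite dotpNr dotp_deltar => le1 le2.
  apply: (@le_trans _ _ (`|h (delta_mx ord0 i)| + `|h (- delta_mx ord0 i)|)).
    rewrite ler_norml; have := ler_norm (h (delta_mx ord0 i)).
    have := ler_norm (h (- delta_mx ord0 i)).
    have := normr_ge0 (h (delta_mx ord0 i)); have := normr_ge0 (h (- delta_mx ord0 i)).
    by move=> *; apply/andP; split; lra.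
  rewrite /M (bigD1 i) //= lerDl; apply: sumr_ge0 => j _.
  by rewrite addr_ge0.
rewrite (_ : halfspace_body h =
  \bigcap_(u in usphere R n) ((fun x => dotp x u) @^-1` [set y | y <= h u])) //.
apply: closed_bigI => u _; apply: closed_comp => [x _|]; last exact: closed_le.
exact/differentiable_continuous/differentiable_dotp.
Qed.

Variables (h : 'rV[R]_n -> R) (r : R).
Hypothesis r_ge0 : 0 <= r.
Hypothesis width : forall u, usphere R n u -> h u + h (- u) = r.
Hypothesis touch : forall u, usphere R n u ->
  exists2 p, halfspace_body h p & dotp p u = h u.

Lemma width_le x y u : halfspace_body h x -> halfspace_body h y ->
  usphere R n u -> dotp u (x - y) <= r.
Proof.
move=> Cx Cy uS; have := Cx _ uS; have := Cy _ (usphereN uS).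
by rewrite -(width uS) dotpBr dotpNr !(dotpC u); lra.
Qed.

Lemma constant_diameter_halfspace_body : constant_diameter r (halfspace_body h).
Proof.
move=> u uS; apply/le_anti/andP; split.
  by apply: ge_ereal_sup => _ [x Cx [y Cy <-]]; rewrite lee_fin; exact: width_le.
have [p Cp pu] := touch uS; have [q Cq qu] := touch (usphereN uS).
apply: ereal_sup_ubound; exists p => //; exists q => //.
by congr (_%:E); rewrite dotpBr !(dotpC u) pu -(width uS) -qu dotpNr.
Qed.

Lemma bounded_byP (B : set 'rV[R]_n) :
  bounded_by r B <-> forall x y, B x -> B y -> enorm (x - y) <= r.
Proof.
split=> [Br x y Bx By|Br].
  rewrite -lee_fin; apply: le_trans Br; apply: ereal_sup_ubound.
  by exists x => //; exists y.
by apply: ge_ereal_sup => _ [x Bx [y By <-]]; rewrite lee_fin; exact: Br.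
Qed.

(** A point [y] that can be added to the body is at distance at most [r] from
    the contact point [p] in the direction [- u], whence
    [y . u <= r + p . u = r - h (- u) = h u]. *)
Lemma maximal_by_halfspace_body : maximal_by r (halfspace_body h).
Proof.
split.
  apply/bounded_byP => x y Cx Cy.
  have [->|xy] := eqVneq x y.
    by rewrite subrr enorm0.
  rewrite -subr_eq0 in xy; rewrite -(dotp_normalize xy).
  by apply: width_le => //; exact: usphere_normalize.
move=> B /bounded_byP Br CB; apply/seteqP; split=> // y By u uS.
have [p Cp pu] := touch (usphereN uS).
have := le_trans (dotp_le_enorm (y - p) uS) (Br _ _ By (CB _ Cp)).
by rewrite -(width uS) -pu dotpBl dotpNr; lra.
Qed.

End ConstantWidth.

(** * Odd functions on the sphere *)

Lemma homog_extZ (R : realType) n (g : 'rV[R]_n -> R) :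
  (forall u, usphere R n u -> g (- u) = - g u) ->
  forall c x, homog_ext g (c *: x) = c * homog_ext g x.
Proof.
move=> godd c x; rewrite /homog_ext enormZ.
have [->|x0] := eqVneq x 0.
  by rewrite enorm0 !(mulr0, mul0r).
have -> : (`|c| * enorm x)^-1 *: (c *: x) = (`|c|^-1 * c) *: ((enorm x)^-1 *: x).
  by rewrite !scalerA invfM; congr (_ *: _); ring.
have [->|c0] := eqVneq c 0; first by rewrite normr0 !mul0r.
case: (ltrgt0P c) c0 => // [c0|c0] _.
  by rewrite mulVf ?gt_eqF // scale1r mulrA.
rewrite invrN [X in X *: _]mulNr mulVf ?lt_eqF // scaleN1r.
by rewrite godd; [ring|exact: usphere_normalize].
Qed.

Theorem theorem0p4 (R : realType) (n : nat) (n_ge2 : (2 <= n)%N) (r : R)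
    (r_gt0 : 0 < r) (g : 'rV[R]_n -> R) :
  let S := usphere R n in
  Ck_usphere 2 g ->
  (forall u, S u -> g (- u) = - g u) ->
  let H := grad (homog_ext g) in
  (forall u, S u -> forall a : R,
     eigenvalue (hessian (homog_ext g) u) a -> - (r / 2) <= a <= r / 2) ->
  let C := [set H u + (t * (r / 2)) *: u | u in S & t in `[(-1 : R), 1]] in
  [/\ C = [set H u + (t * (r / 2)) *: u | u in S & t in `[(0 : R), 1]],
      solid C, constant_diameter r C & maximal_by r C].
Proof.
move=> S gC2 godd H eigH C.
have GZ := homog_extZ godd.
have GC := Ck_homog_ext gC2.
set G := homog_ext g in H eigH C GZ GC *.
pose rho := r / 2; have rho0 : 0 < rho by rewrite divr_gt0.
pose h u := G u + rho.
set C01 := (X in C = X).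
have GN u : G (- u) = - G u by rewrite -scaleN1r GZ mulN1r.
have HN u : S u -> H (- u) = H u.
  move=> uS; rewrite -scaleN1r; apply: (homog_grad_scale GZ GC).
    by rewrite oppr_eq0 oner_eq0.
  exact: usphere_neq0 uS.
have support u w : S u -> S w -> dotp (H u + rho *: u) w <= h w.
  move=> uS wS; apply: support_inequality => //; first exact: ltW.
  by move=> x xS a /(eigH x xS) /andP[].
have CK : C `<=` halfspace_body h.
  move=> _ [u uS [t /= + <-]] w wS; rewrite in_itv /= => /andP[t_ge t_le].
  have := support u w uS wS; have := support (- u) w (usphereN uS) wS.
  rewrite HN // scalerN !dotpDl dotpNl !dotpZl -/rho.
  set a := dotp _ w; set b := dotp u w => le1 le2.
  (* [t] is the barycentre of [1] and [-1] with weights [(1 + t) / 2] and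
     [(1 - t) / 2] *)
  have : (1 + t) * (a + rho * b) <= (1 + t) * h w by apply: ler_wpM2l => //; lra.
  have : (1 - t) * (a - rho * b) <= (1 - t) * h w by apply: ler_wpM2l => //; lra.
  by lra.
have KC : halfspace_body h `<=` C01.
  move=> x Kx; have eS := @usphere_delta R n (Ordinal (ltnW n_ge2)).
  have [u [m [uS /andP[m0 m_le] xE]]] := support_parametrization GZ GC eS Kx.
  exists u => //; exists (m / rho).
    rewrite /= in_itv /=; apply/andP; split; first by rewrite divr_ge0 // ltW.
    by rewrite ler_pdivrMr // mul1r.
  by rewrite -/rho divfK ?gt_eqF.
have C01C : C01 `<=` C.
  move=> _ [u uS [t /= + <-]]; rewrite in_itv /= => /andP[t0 t1].
  exists u => //; exists t => //=; rewrite in_itv /= t1 andbT.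
  by apply: le_trans t0; rewrite lerN10.
have CE : C = halfspace_body h.
  by apply/seteqP; split=> // x /KC /C01C.
have width u : S u -> h u + h (- u) = r.
  by move=> _; rewrite /h GN /rho; lra.
have touch u : S u -> exists2 p, halfspace_body h p & dotp p u = h u.
  move=> uS; exists (H u + rho *: u); first by move=> w; exact: support.
  have /usphereP uu := uS.
  by rewrite dotpDl dotpZl uu mulr1 homog_euler // usphere_neq0.
split; first by apply/seteqP; split=> // x /CK /KC.
- by rewrite CE; exact: solid_halfspace_body.
- by rewrite CE; exact: constant_diameter_halfspace_body.
- by rewrite CE; apply: maximal_by_halfspace_body => //; exact: ltW.
Qed.
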